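(* Let $X$ be a Polish space and $n\in\mathbb N$. Then: (1) $\mathcal A_n(X)$ and, for every $F\in\mathcal K(X)$, $\mathcal A_n(X,F)$ are absolute $F_{\sigma\delta}$-spaces; (2) $\mathcal A_\omega(X)$ is an absolute $F_{\sigma\delta\sigma}$-space; (3) for every $F_\sigma$-subset $F$ of $X$, the spaces $\mathcal A_n(F,X)$, $\mathcal A_n(X,F)$ and $\mathcal A_n(F)$ are absolutely of type $D_{2n}(F_{\sigma\delta})$.
   Context: $\mathbb N=\{1,2,\dots\}$. $\mathcal K(X)$ is the space of all nonempty compact subsets of $X$ with the Vietoris topology; $A'$ is the set of accumulation points of $A$. $\mathcal A_n(X)=\{A\in\mathcal K(X):1\le|A'|\le n\}$, $\mathcal A_\omega(X)=\{A\in\mathcal K(X):1\le|A'|<\omega\}$. For $E,F\subset X$: $\mathcal A_n(E,F)=\{A\in\mathcal A_n(X):A\setminus A'\subset E,\ A'\subset F\}$, and $\mathcal A_n(F)$ is the set of $A\in\mathcal A_n(X)$ with $A\subset F$. For a family $\Gamma$ of subsets of a space, $D_{2n}(\Gamma)$ is the family of sets $\bigcup_{k=1}^n(A_{2k}\setminus A_{2k-1})$ with $A_1\subset\dots\subset A_{2n}$ elements of $\Gamma$; type $D_{2n}(F_{\sigma\delta})$ means membership in $D_{2n}(\Gamma)$ for $\Gamma$ the family of $F_{\sigma\delta}$-subsets. A space is absolutely of a given type if it is of that type in every metrizable space in which it is topologically embedded. *)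

(* Defs.v *)
From HB Require Import structures.
From mathcomp Require Import all_boot all_order all_algebra.
From mathcomp Require Import all_classical all_reals all_analysis.
From mathcomp Require Import borel_hierarchy.

Set Implicit Arguments.
Unset Strict Implicit.
Unset Printing Implicit Defensive.

Local Open Scope classical_set_scope.
Local Open Scope card_scope.

Definition homeomorphic (S T : topologicalType) : Prop :=
  exists (f : S -> T) (g : T -> S),
    [/\ cancel f g, cancel g f, continuous f & continuous g].

Definition embedding (S T : topologicalType) (f : S -> T) : Prop :=
  [/\ injective f, continuous f &
      forall U : set S, open U ->
        exists2 V : set T, open V & f @` U = V `&` range f].

Definition separable (T : topologicalType) : Prop :=
  exists2 D : set T, countable D & dense D.

Definition metrizable (R : realType) (T : topologicalType) : Prop :=
  exists M : metricType R, homeomorphic T M.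

(* [completeType] is not used because it requires a distinguished point,
   whereas a Polish space may be empty. *)
Definition complete_metric (R : realType) (M : metricType R) : Prop :=
  forall u : nat -> M, cauchy (u @ \oo) -> exists l : M, u @ \oo --> l.

Definition polish (R : realType) (T : topologicalType) : Prop :=
  separable T /\
  exists2 M : metricType R, complete_metric M & homeomorphic T M.

(* The hyperspace K(X) of nonempty compact subsets of X. *)
Record hyperspace (X : topologicalType) := Hyperspace {
  hset :> set X;
  hset_compact : compact hset;
  hset_neq0 : hset !=set0 }.

HB.instance Definition _ (X : topologicalType) := gen_eqMixin (hyperspace X).
HB.instance Definition _ (X : topologicalType) :=
  gen_choiceMixin (hyperspace X).

(* Subbasic sets of the Vietoris topology: [A `<=` U] for [(true, U)] and
   [A] meets [U] for [(false, U)]. *)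
Definition vietoris_subbase (X : topologicalType) (i : bool * set X) :
    set (hyperspace X) :=
  if i.1 then [set A : hyperspace X | A `<=` i.2]
  else [set A : hyperspace X | A `&` i.2 !=set0].

HB.instance Definition _ (X : topologicalType) :=
  isSubBaseTopological.Build (hyperspace X)
    [set i : bool * set X | open i.2] (@vietoris_subbase X).

Section accumulation_classes.
Variable X : topologicalType.
Implicit Types (n : nat) (E F : set X).

Definition acc (A : hyperspace X) : set X := limit_point (hset A).

Definition cA n : set (hyperspace X) :=
  [set A : hyperspace X | acc A !=set0 /\ acc A #<= `I_n].

Definition cA_omega : set (hyperspace X) :=
  [set A : hyperspace X | acc A !=set0 /\ finite_set (acc A)].

Definition cA2 n E F : set (hyperspace X) :=
  [set A : hyperspace X |
    [/\ cA n A, A `\` acc A `<=` E & acc A `<=` F]].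

Definition cA1 n F : set (hyperspace X) :=
  [set A : hyperspace X | cA n A /\ A `<=` F].

End accumulation_classes.

Arguments cA : clear implicits.
Arguments cA_omega : clear implicits.

Definition Fsigmadelta (T : topologicalType) : set (set T) :=
  [set S : set T | exists2 F : nat -> set T,
    (forall i, Fsigma (F i)) & S = \bigcap_i F i].

Definition Fsigmadeltasigma (T : topologicalType) : set (set T) :=
  [set S : set T | exists2 F : nat -> set T,
    (forall i, Fsigmadelta (F i)) & S = \bigcup_i F i].

(* The family D_{2n}(G), with [n] (not [2n]) as argument. The sequence is
   indexed from 1: only the values A_1, ..., A_{2n} of [A] matter. *)
Definition D2 (T : Type) (n : nat) (G : set (set T)) : set (set T) :=
  [set S : set T | exists A : nat -> set T,
    [/\ forall i, (1 <= i <= n.*2)%N -> G (A i),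
        forall i, (1 <= i < n.*2)%N -> A i `<=` A i.+1 &
        S = \bigcup_(k in [set k : nat | (1 <= k <= n)%N])
              (A k.*2 `\` A (k.*2).-1)]].

Definition absolutely (R : realType)
    (P : forall Z : topologicalType, set (set Z)) (Y : topologicalType) : Prop :=
  forall Z : topologicalType, metrizable R Z ->
  forall f : Y -> Z, embedding f -> P Z (range f).

(* Main.v *)
(* A subset Y of K(X) may be studied inside K(X) itself: if f embeds Y in a
   metrizable space Z, its inverse extends continuously to the set of points of
   the closure of f(Y) where the oscillation of the inverse vanishes, which is
   Fsigmadelta because K(X) is completely metrized by the Hausdorff distance,
   and f(Y) is exactly the preimage of Y under this extension.

   Inside K(X), the key fact is that for every Fsigma set F the condition that
   A' `&` F has fewer than k points is Fsigmadelta: the opposite inequality is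
   witnessed by k basic open sets with disjoint closures, each of them
   containing, for some closed piece C of F and every r, two distinct points
   of A that are 1/r-close to each other and to C. The condition that A \ A' is
   contained in F is Fsigmadelta as well, so only A' `<=` F raises the type to
   D_{2n}: an A with |A'| <= k satisfies |A'| = k and A' `<=` F iff A' `&` F has
   at least k points, and the chain is
     A_{2k-1} = {|A'| <= k, |A' `&` F| < k},  A_{2k} = {|A'| <= k}. *)
From HB Require Import structures.
Require Import Defs.
From mathcomp Require Import all_boot all_order all_algebra.
From mathcomp Require Import all_classical all_reals all_analysis.
From mathcomp Require Import borel_hierarchy.

Set Implicit Arguments.
Unset Strict Implicit.
Unset Printing Implicit Defensive.

Import Order.TTheory GRing.Theory Num.Theory.
Import numFieldNormedType.Exports.

Local Open Scope classical_set_scope.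
Local Open Scope card_scope.
Local Open Scope ring_scope.

(** * Filter completeness, and metrics moved onto the space itself *)

Definition filter_complete (T : uniformType) :=
  forall F : set_system T, ProperFilter F -> cauchy F -> exists l : T, F --> l.

(** A Cauchy filter has members [S k] any two points of which are [1/(k+1)]-close. Picking [u k] in
    the intersection of [S 0], ..., [S k] gives a Cauchy sequence, and its limit is a limit of the
    filter. *)
Lemma complete_metric_filter (R : realType) (M : metricType R) :
  complete_metric M -> filter_complete M.
Proof.
move=> cM F PF /cauchy_ballP cF.
have S_ k : exists S : set M,
    F S /\ forall x y, S x -> S y -> ball x k.+1%:R^-1 y.
  have /cF [[P Q] /= [FP FQ] PQ] : 0 < k.+1%:R^-1 :> R by [].
  exists (P `&` Q); split; first exact: filterI.
  by move=> x y [Px _] [_ Qy]; exact: (PQ (x, y)).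
have [S /all_and2[FS dS]] := choice S_.
have /choice[u uS] : forall k, exists x : M, forall j, (j <= k)%N -> S j x.
  move=> k; suff : F [set x | forall j, (j <= k)%N -> S j x] by move/filter_ex.
  elim: k => [|k].
    by apply: filterS (FS 0%N) => x Sx j; rewrite leqn0 => /eqP ->.
  apply: filterS2 (FS k.+1) => x Sx IH j /=.
  by rewrite leq_eqVlt ltnS => /predU1P[->//|]; exact: IH.
have uu k j : (k <= j)%N -> ball (u k) k.+1%:R^-1 (u j).
  by move=> kj; apply: dS; exact: uS.
have [l ul] : exists l : M, u @ \oo --> l.
  apply: cM; apply: (@cauchy_exP R M) => e e0.
  near \oo => k; exists (u k).
  suff : \forall j \near \oo, ball (u k) e (u j) by [].
  near=> j.
  apply: (@le_ball _ _ _ k.+1%:R^-1); last by apply: uu; near: j;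
    exact: nbhs_infty_ge.
  by apply: ltW; near: k; exact: (near_infty_natSinv_lt (PosNum e0)).
exists l => V /nbhs_ballP[e /= e0 eV].
have e20 : 0 < e / 2 by rewrite divr_gt0.
have lu : \forall k \near \oo, ball l (e / 2) (u k).
  exact: (ul _ (nbhsx_ballx l _ e20)).
near \oo => k.
apply: filterS (FS k) => x Sx; apply: eV; apply: (ball_split (z := u k)).
  by near: k.
apply: (@le_ball _ _ _ k.+1%:R^-1); last by apply: dS => //; exact: uS.
by apply: ltW; near: k; exact: (near_infty_natSinv_lt (PosNum e20)).
Unshelve. all: by end_near. Qed.

(** The metric is pulled back along the homeomorphism. The equality of topological types then allows
    [X] to be replaced by [M'] everywhere, so that no hyperspace has to be transported; being
    Hausdorff records what separates a metric from a pseudometric. *)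
Lemma homeomorphic_pseudoMetric (R : realType) (X : topologicalType)
    (M : metricType R) : homeomorphic X M ->
  exists M' : pseudoMetricType R, [/\ X = M' :> topologicalType,
    hausdorff_space M' & filter_complete M -> filter_complete M'].
Proof.
(* Once [X] is a constructor, its topology and that of [M'] are convertible. *)
case: X => X0 [c1 c2 c3 c4 c5].
set X : topologicalType := Topological.Pack _.
case=> f [g [fK gK fc gc]].
pose I : pseudoMetricType R := initial_topology f.
have nbhsI (x : X) : nbhs x = nbhs (x : I).
  apply/seteqP; split=> U; last first.
    case=> _ [[V oV <-] /= Vfx VU]; apply: (filterS VU).
    by apply: fc; exact: open_nbhs_nbhs.
  rewrite nbhsE => -[V [oV Vx] VU]; exists V => //; split=> //.
  exists (g @^-1` V); first by move/continuousP: gc; apply.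
  by apply/seteqP; split=> y /=; rewrite /preimage /= ?fK.
have nE : @nbhs _ X = nbhs_ (@entourage I).
  apply/funext => x; rewrite nbhsI; apply/seteqP.
  by split=> U; rewrite nbhs_entourageE.
have split_ent (A : set (X * X)) : @entourage I A ->
    exists2 B, @entourage I B & (B \; B `<=` A)%relation.
  exact: (@entourage_split_ex I).
pose u := Nbhs_isUniform_mixin.Build X (@entourage_filter I)
  (@entourage_diagonal_subproof I) (@entourage_inv I) split_ent nE.
pose XU : uniformType := HB.pack (Topological.sort X) X u.
pose p := Uniform_isPseudoMetric.Build R XU (@ball_center_subproof R I)
  (@ball_sym R I) (fun x y z => @ball_triangle R I y x z)
  (@entourageE_subproof R I).
pose M' : pseudoMetricType R := HB.pack (Topological.sort X) XU p.
exists M'; split.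
- by [].
- move=> x y xy; apply: (can_inj fK);
    apply: (@metric_hausdorff _ M) => A B Ax By.
  have [z [Az Bz]] := xy _ _ (fc x A Ax) (fc y B By).
  by exists (f z).
- move=> cM F PF /cauchyP cF.
  have [|l Fl] := cM (f @ F) _.
    apply: cauchy_exP => e e0; have [x Fx] := cF e e0.
    by exists (f x).
  exists (g l) => V /gc gV; have Fg : F (f @^-1` (g @^-1` V)) := Fl _ gV.
  by apply: filterS Fg => x; rewrite /preimage /= fK.
Qed.

(** * Absolute Borel type of subspaces of complete spaces *)

Section classes.
Variable T : topologicalType.
Implicit Types A B : set T.

Lemma Fsigma_bigcup (I : countType) (P : set I) (F : I -> set T) :
  (forall i, P i -> Fsigma (F i)) -> Fsigma (\bigcup_(i in P) F i).
Proof.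
move=> sF.
have /choice[G GP] i : exists G : nat -> set T,
    P i -> (forall j, closed (G j)) /\ F i = \bigcup_j G j.
  have [Pi|nPi] := pselect (P i); last by exists (fun=> set0).
  by have [G cG FG] := sF i Pi; exists G.
exists (fun n => if unpickle n is Some (i, j) then
    if `[< P i >] then G i j else set0 else set0).
  move=> n; case: unpickle => [[i j]|]; last exact: closed0.
  by case: asboolP => [/GP[]//|_]; exact: closed0.
apply/seteqP; split=> x.
  case=> i Pi; rewrite (GP i Pi).2 => -[j _ Gx].
  by exists (pickle (i, j)) => //; rewrite pickleK asboolT.
case=> n _; case: unpickle => [[i j]|//]; case: asboolP => // Pi Gx.
by exists i => //; rewrite (GP i Pi).2; exists j.
Qed.

Lemma Fsigma_Fsigmadelta A : Fsigma A -> Fsigmadelta A.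
Proof. by move=> sA; exists (fun=> A) => //; rewrite bigcap_const. Qed.

Lemma Fsigmadelta_bigcap (J : countType) (P : set J) (F : J -> set T) :
  (forall i, P i -> Fsigmadelta (F i)) -> Fsigmadelta (\bigcap_(i in P) F i).
Proof.
move=> sF.
have /choice[G GP] i : exists G : nat -> set T,
    P i -> (forall j, Fsigma (G j)) /\ F i = \bigcap_j G j.
  have [Pi|nPi] := pselect (P i); last by exists (fun=> set0).
  by have [G cG FG] := sF i Pi; exists G.
exists (fun n => if unpickle n is Some (i, j) then
    if `[< P i >] then G i j else setT else setT).
  move=> n; case: unpickle => [[i j]|]; last exact/closed_Fsigma/closedT.
  by case: asboolP => [/GP[]//|_]; exact/closed_Fsigma/closedT.
apply/seteqP; split=> x.
  move=> Fx n _; case: unpickle => [[i j]|//]; case: asboolP => // Pi.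
  by have := Fx i Pi; rewrite (GP i Pi).2; exact.
move=> Gx i Pi; rewrite (GP i Pi).2 => j _.
by have := Gx (pickle (i, j)) I; rewrite pickleK asboolT.
Qed.

Lemma Fsigma_setI A B : Fsigma A -> Fsigma B -> Fsigma (A `&` B).
Proof.
move=> [F cF ->] [G cG ->].
have -> : \bigcup_i F i `&` \bigcup_i G i =
    \bigcup_(p : nat * nat) (F p.1 `&` G p.2).
  apply/seteqP; split=> x; first by move=> [[i _ Fx] [j _ Gx]]; exists (i, j).
  by move=> [[i j] _ [Fx Gx]]; split; [exists i|exists j].
by apply: Fsigma_bigcup => p _; apply: closed_Fsigma; exact: closedI.
Qed.

Lemma Fsigma_setU A B : Fsigma A -> Fsigma B -> Fsigma (A `|` B).
Proof.
move=> sA sB.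
have -> : A `|` B = \bigcup_(b : bool) (if b then A else B).
  apply/seteqP; split=> x; first by case; [exists true|exists false].
  by case=> -[] _; [left|right].
by apply: Fsigma_bigcup => -[].
Qed.

Lemma Fsigmadelta_setI A B :
  Fsigmadelta A -> Fsigmadelta B -> Fsigmadelta (A `&` B).
Proof.
move=> sA sB.
have -> : A `&` B = \bigcap_(b : bool) (if b then A else B).
  apply/seteqP; split=> x; first by case=> Ax Bx -[].
  by move=> ABx; split; [exact: (ABx true)|exact: (ABx false)].
by apply: Fsigmadelta_bigcap => -[].
Qed.

Lemma D2_Fsigmadelta n A : (1 <= n)%N -> Fsigmadelta A ->
  D2 n (@Fsigmadelta T) A.
Proof.
(* The chain is empty at index 1 and constantly [A] afterwards: the difference for [k = 1] is [A],
   all later ones are empty. *)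
move=> n1 sA; exists (fun i => if (i <= 1)%N then set0 else A); split.
- move=> i _; case: ifP => // _.
  exact/Fsigma_Fsigmadelta/closed_Fsigma/closed0.
- by move=> [//|i] _; case: ifP => _; [exact: sub0set|exact: subset_refl].
- apply/seteqP; split=> x.
    by move=> Ax; exists 1%N => //=; split.
  case=> k /= /andP[k1 _] []; case: ifP => //.
Qed.

End classes.

(** Points whose [1/(k+1)]-ball lies in [U] exhaust [U]. Taking closures does not leave [U]: a point
    of the closure is in the [1/(k+1)]-ball of such a point. *)
Lemma open_Fsigma (R : realType) (M : pseudoMetricType R) (U : set M) :
  open U -> Fsigma U.
Proof.
move=> oU.
exists (fun k => closure [set x | ball x k.+1%:R^-1 `<=` U]).
  by move=> k; exact: closed_closure.
apply/seteqP; split=> x.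
  move=> Ux; have /nbhs_ballP[e /= e0 eU] : nbhs x U by exact: open_nbhs_nbhs.
  near \oo => k; exists k => //; apply: subset_closure => /=.
  apply: subset_trans eU; apply: le_ball; apply: ltW.
  by near: k; exact: (near_infty_natSinv_lt (PosNum e0)).
case=> k _ /(_ (ball x k.+1%:R^-1)) [|y [yU /ball_sym]]; last exact: yU.
exact: nbhsx_ballx.
Unshelve. all: by end_near. Qed.

(** * Extending the inverse of an embedding *)

Section extension.
Variables (R : realType) (K Z : pseudoMetricType R) (Y : set K) (f : Y -> Z).
Hypotheses (hK : hausdorff_space K) (hZ : hausdorff_space Z).
Hypotheses (cK : filter_complete K) (ef : embedding f).

(** The limit of this filter, if it exists, is the value at [z] of the extended inverse of [f]. The
    extension is partial, so it is handled through this convergence relation and not as a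
    function. *)
Definition trace_filter (z : Z) : set_system K :=
  [set V | exists2 N, nbhs z N & forall y : Y, N (f y) -> V (\val y)].

Definition extension_preimage (A : set K) : set Z :=
  [set z | closure (range f) z /\ exists2 x : K, A x & trace_filter z --> x].

Local Notation Phi := extension_preimage.

Local Instance trace_filter_filter z : Filter (trace_filter z).
Proof.
split; first by exists setT => //; exact: filterT.
- move=> P Q [N1 zN1 N1P] [N2 zN2 N2P]; exists (N1 `&` N2);
    first exact: filterI.
  by move=> y [/N1P Py /N2P Qy].
- by move=> P Q PQ [N zN NP]; exists N => // y /NP /PQ.
Qed.

Lemma trace_filter_proper z : closure (range f) z ->
  ProperFilter (trace_filter z).
Proof.
move=> cz; apply: Build_ProperFilter_ex => P [N zN NP].
by have [_ [[y _ <-] /NP]] := cz _ zN; exists (\val y).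
Qed.

Lemma trace_filter_unique z (x x' : K) : closure (range f) z ->
  trace_filter z --> x -> trace_filter z --> x' -> x = x'.
Proof.
move=> /trace_filter_proper PF zx zx'; apply: hK => A B xA x'B.
by apply: (@filter_ex _ _ PF); apply: filterI; [exact: zx|exact: zx'].
Qed.

Lemma trace_filter_val (y : Y) : trace_filter (f y) --> \val y.
Proof.
case: ef => finj fc fo V yV.
have [|W oW fW] := fo (set_val @^-1` V°).
  by exists (V°) => //; exact: open_interior.
exists W.
  apply: open_nbhs_nbhs; split=> //.
  suff [] : (W `&` range f) (f y) by [].
  by rewrite -fW; exists y.
move=> y' Wy'.
have : (W `&` range f) (f y') by split.
by rewrite -fW => -[y'' + /finj <-]; exact: interior_subset.
Qed.

(** No new point is sent into [Y]: points [f y'] close to [z] have [y'] close to [y], so by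
    continuity they are also close to [f y], and [Z] is Hausdorff. *)
Lemma trace_filter_eq z (y : Y) : closure (range f) z ->
  trace_filter z --> \val y -> z = f y.
Proof.
move=> cz zy; case: (ef) => _ fc _; apply: hZ => A B Az By.
have [_ [[V oV <-] /= Vy VB]] := fc y B By.
have [N zN NV] : trace_filter z V by apply: zy; exact: open_nbhs_nbhs.
have [_ [[y' _ <-] [Ny' Ay']]] := cz _ (filterI zN Az).
by exists (f y'); split=> //; apply: VB; exact: NV.
Qed.

Lemma extension_preimage_domain : Phi Y = range f.
Proof.
apply/seteqP; split=> z.
  move=> [cz [x Yx zx]]; exists (exist _ x (mem_set Yx)) => //.
  by apply/esym/trace_filter_eq.
case=> y _ <-; split; first by apply: subset_closure; exists y.
by exists (\val y); [exact: set_valP|exact: trace_filter_val].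
Qed.

Lemma extension_preimageS A B : A `<=` B -> Phi A `<=` Phi B.
Proof. by move=> AB z [cz [x /AB Bx zx]]; split=> //; exists x. Qed.

Lemma extension_preimage_bigcup I (P : set I) (A : I -> set K) :
  Phi (\bigcup_(i in P) A i) = \bigcup_(i in P) Phi (A i).
Proof.
apply/seteqP; split=> z.
  by case=> cz [x [i Pi Ax] zx]; exists i => //; split=> //; exists x.
by case=> i Pi [cz [x Ax zx]]; split=> //; exists x => //; exists i.
Qed.

Lemma extension_preimage_bigcap (A : nat -> set K) :
  Phi (\bigcap_i A i) = \bigcap_i Phi (A i).
Proof.
apply/seteqP; split=> z.
  by move=> [cz [x Ax zx]] i _; split=> //; exists x => //; exact: Ax.
move=> Az; have [cz [x _ zx]] := Az 0%N I.
split=> //; exists x => // i _; have [_ [x' Ax' zx']] := Az i I.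
by rewrite (trace_filter_unique cz zx zx').
Qed.

Lemma extension_preimageD A B : Phi (A `\` B) = Phi A `\` Phi B.
Proof.
apply/seteqP; split=> z.
  move=> [cz [x [Ax nBx] zx]]; split; first by split=> //; exists x.
  by case=> _ [x' Bx' zx']; apply: nBx; rewrite (trace_filter_unique cz zx zx').
case=> -[cz [x Ax zx]] nB; split=> //; exists x => //; split=> // Bx.
by apply: nB; split=> //; exists x.
Qed.

(* [trace_filter z] converges iff [z] is a closure point where the inverse of
   [f] has zero oscillation, and this is a countable intersection of open
   conditions. *)
Lemma Fsigmadelta_extension_domain : Fsigmadelta (Phi setT).
Proof.
pose O k := [set z : Z | exists2 N, nbhs z N &
  forall y y' : Y, N (f y) -> N (f y') -> ball (\val y) k.+1%:R^-1 (\val y')].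
have -> : Phi setT = closure (range f) `&` \bigcap_k O k.
  apply/seteqP; split=> z.
    move=> [cz [x _ zx]]; split=> // k _.
    have [|N zN Nx] := zx (ball x (k.+1%:R^-1 / 2)).
      by apply: nbhsx_ballx; rewrite divr_gt0.
    by exists N => // y y' /Nx xy /Nx xy'; exact: ball_splitr xy xy'.
  move=> [cz Oz]; split=> //; have PF := trace_filter_proper cz.
  have [|x zx] := cK PF; last by exists x.
  apply: (@cauchy_exP R K) => e e0; near \oo => k.
  have [N zN NO] := Oz k I; have [_ [[y _ <-] Ny]] := cz _ zN.
  exists (\val y); exists N => // y' Ny'.
  apply: (@le_ball _ _ _ k.+1%:R^-1); last exact: NO.
  by apply: ltW; near: k; exact: (near_infty_natSinv_lt (PosNum e0)).
apply: Fsigmadelta_setI;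
  first exact/Fsigma_Fsigmadelta/closed_Fsigma/closed_closure.
apply: Fsigmadelta_bigcap => k _; apply/Fsigma_Fsigmadelta/open_Fsigma.
rewrite openE => z [N]; rewrite nbhsE => -[V [oV Vz] VN] NO.
apply: (@filterS _ _ _ V); last exact: open_nbhs_nbhs.
by move=> z' Vz'; exists V; [exact: open_nbhs_nbhs|move=> y y' /VN ? /VN;
  exact: NO].
Unshelve. all: by end_near. Qed.

(** This is continuity of the extension on its domain. If the limit [x] at a point of [D] were off
    [C], regularity would give a neighbourhood [B] of [x] with closure off [C]; the complement of
    that closure is one of the sets [V] defining [D], against the convergence to [x]. *)
Lemma closed_extension_preimage C : closed C ->
  exists2 D, closed D & Phi C = Phi setT `&` D.
Proof.
move=> cC; pose D := \bigcap_(V in [set V : set K | open V /\ C `<=` V])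
  closure [set f y | y in [set y : Y | V (\val y)]].
exists D; first by apply: closed_bigI => V _; exact: closed_closure.
apply/seteqP; split=> z.
  move=> [cz [x Cx zx]]; split; first by split=> //; exists x.
  move=> V [oV CV] B zB.
  have [N zN NV] : trace_filter z V
    by apply: zx; apply: open_nbhs_nbhs; split=> //; exact: CV.
  have [_ [[y _ <-] [Ny By]]] := cz _ (filterI zN zB).
  by exists (f y); split=> //; exists y => //; exact: NV.
move=> [[cz [x _ zx]] Dz]; split=> //; exists x => //; apply: contrapT => nCx.
have [B xB BC] : filter_from (nbhs x) closure (~` C).
  by apply: uniform_regular; apply: open_nbhs_nbhs; split=> //;
    exact: closed_openC.
have [N zN NB] := zx _ xB.
have [|z' [[y /= nBy <-] /NB By]] := Dz (~` closure B) _ _ zN.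
  split; first exact/closed_openC/closed_closure.
  by move=> c Cc /BC.
by apply: nBy; exact: subset_closure.
Qed.

(** Preimages of Fsigma sets are traces on the domain [Phi setT] of Fsigma sets; the domain is
    itself Fsigmadelta and is intersected only once. *)
Lemma Fsigmadelta_extension_preimage A :
  Fsigmadelta A -> Fsigmadelta (Phi A).
Proof.
move=> [F sF ->].
have /choice[G GP] i : exists G, Fsigma G /\ Phi (F i) = Phi setT `&` G.
  have [C cC ->] := sF i.
  have /choice[D DP] j : exists D, closed D /\ Phi (C j) = Phi setT `&` D.
    by have [D] := closed_extension_preimage (cC j); exists D.
  exists (\bigcup_j D j); split.
    by apply: Fsigma_bigcup => j _; apply: closed_Fsigma; exact: (DP j).1.
  by rewrite extension_preimage_bigcup setI_bigcupr; apply: eq_bigcupr => j _;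
    exact: (DP j).2.
rewrite extension_preimage_bigcap.
have -> : \bigcap_i Phi (F i) = Phi setT `&` \bigcap_i G i.
  apply/seteqP; split=> z.
    move=> Fz; split; first by have := Fz 0%N I; rewrite (GP _).2 => -[].
    by move=> i _; have := Fz i I; rewrite (GP _).2 => -[].
  by move=> [Pz Gz] i _; rewrite (GP i).2; split=> //; exact: Gz.
apply: Fsigmadelta_setI; first exact: Fsigmadelta_extension_domain.
apply: Fsigmadelta_bigcap => i _; apply: Fsigma_Fsigmadelta; exact: (GP i).1.
Qed.

End extension.

(** * From the type inside a complete space to the absolute type *)

Section absolute.
Variables (R : realType) (K : pseudoMetricType R) (Y : set K).
Hypotheses (hK : hausdorff_space K) (cK : filter_complete K).

Lemma absolutely_Fsigmadelta : Fsigmadelta Y -> absolutely R Fsigmadelta Y.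
Proof.
move=> sY Z [M /homeomorphic_pseudoMetric[M' [-> hM' _]]] f ef.
rewrite -(extension_preimage_domain hM' ef).
exact: Fsigmadelta_extension_preimage.
Qed.

Lemma absolutely_Fsigmadeltasigma :
  Fsigmadeltasigma Y -> absolutely R Fsigmadeltasigma Y.
Proof.
move=> [F sF YF] Z [M /homeomorphic_pseudoMetric[M' [-> hM' _]]] f ef.
rewrite -(extension_preimage_domain hM' ef).
exists (fun i => extension_preimage f (F i)).
  by move=> i; exact: Fsigmadelta_extension_preimage.
by rewrite -extension_preimage_bigcup -YF.
Qed.

Lemma absolutely_D2 n : D2 n (@Fsigmadelta K) Y ->
  absolutely R (fun Z => D2 n (@Fsigmadelta Z)) Y.
Proof.
move=> [A [sA AS YA]] Z [M /homeomorphic_pseudoMetric[M' [-> hM' _]]] f ef.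
rewrite -(extension_preimage_domain hM' ef).
exists (fun i => extension_preimage f (A i)); split.
- by move=> i /sA; exact: Fsigmadelta_extension_preimage.
- by move=> i /AS; exact: extension_preimageS.
- rewrite {2}YA extension_preimage_bigcup.
  by apply: eq_bigcupr => k _; rewrite extension_preimageD.
Qed.

End absolute.

(** * The hyperspace as a complete pseudometric space *)

Section vietoris.
Variable X : topologicalType.

Lemma open_vietoris_subbase (i : bool * set X) :
  open i.2 -> open (vietoris_subbase i).
Proof.
move=> oi; exists [set vietoris_subbase i]; last by rewrite bigcup_set1.
by move=> _ ->; apply: (@finI_from1 _ _ _ (@vietoris_subbase X)).
Qed.

Lemma cvg_vietoris (F : set_system (hyperspace X)) (A : hyperspace X) :
  Filter F ->
  (forall i, open i.2 -> vietoris_subbase i A -> F (vietoris_subbase i)) ->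
  F --> A.
Proof.
move=> FF FA V [_ [[D sD <-] [C DC CA] DV]].
apply: filterS DV _.
have [J sJ JC] := sD C DC.
have FC : F C.
  rewrite -JC; apply: filter_bigI => i iJ; apply: FA.
    by have /set_mem := sJ i iJ.
  by move: CA; rewrite -JC; exact.
by apply: filterS FC => B CB; exists C.
Qed.

End vietoris.

Section hyperspace_pseudoMetric.
Variables (R : realType) (M : pseudoMetricType R).

Definition thickening (A : set M) (e : R) : set M :=
  [set y | exists2 x, A x & ball x e y].

Definition hausdorff_ball (A : hyperspace M) (e : R) (B : hyperspace M) :=
  A `<=` thickening B e /\ B `<=` thickening A e.

Let hausdorff_ball_center A (e : R) : 0 < e -> hausdorff_ball A e A.
Proof. by move=> e0; split=> x Ax; exists x => //; exact: ballxx. Qed.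

Let hausdorff_ball_sym A B (e : R)
  : hausdorff_ball A e B -> hausdorff_ball B e A.
Proof. by case. Qed.

Lemma thickening_trans (A B C : set M) (e1 e2 : R) :
  A `<=` thickening B e1 -> B `<=` thickening C e2 ->
  A `<=` thickening C (e1 + e2).
Proof.
move=> AB BC x /AB[b /BC[c Cc cb] bx]; exists c => //.
by rewrite addrC; exact: ball_triangle cb bx.
Qed.

Let hausdorff_ball_triangle A B C (e1 e2 : R) :
  hausdorff_ball A e1 B -> hausdorff_ball B e2 C ->
  hausdorff_ball A (e1 + e2) C.
Proof.
move=> [AB BA] [BC CB]; split; first exact: thickening_trans AB BC.
by rewrite addrC; exact: thickening_trans CB BA.
Qed.

Lemma le_thickening (A : set M) (e1 e2 : R) :
  e1 <= e2 -> thickening A e1 `<=` thickening A e2.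
Proof. by move=> e12 y [x Ax xy]; exists x => //; exact: le_ball xy. Qed.

Let le_hausdorff_ball A (e1 e2 : R) :
  e1 <= e2 -> hausdorff_ball A e1 `<=` hausdorff_ball A e2.
Proof.
move=> e12 B [AB BA]; split.
  by apply: subset_trans AB _; exact: le_thickening.
by apply: subset_trans BA _; exact: le_thickening.
Qed.

Lemma thickening_nbhs (A : set M) (e : R) : 0 < e -> A `<=` (thickening A e)°.
Proof.
move=> e0 x Ax; apply: (@filterS _ _ _ (ball x e)); last exact: nbhsx_ballx.
by move=> y xy; exists x.
Qed.

Lemma compact_sub_open_thickening (A U : set M) : compact A -> open U ->
  A `<=` U -> exists2 e : R, 0 < e & thickening A e `<=` U.
Proof.
move=> /compact_near_coveringP cA oU AU.
have Ue : \forall e \near 0^'+, A `<=` [set x | ball x e `<=` U].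
  apply: (cA R 0^'+ (fun e x => ball x e `<=` U)) => x Ax.
  have /nbhs_ballP[r /= r0 rU] : nbhs x U
    by apply: open_nbhs_nbhs; split; [|exact: AU].
  have r20 : 0 < r / 2 by rewrite divr_gt0.
  near=> x' e.
  have er : e <= r / 2 by near: e; exact: nbhs_right_le.
  have xx' : ball x (r / 2) x' by near: x'; exact: nbhsx_ballx.
  by move=> y x'y; apply/rU/(ball_split xx')/(le_ball er).
near (0 : R)^'+ => e; exists e => // y [x Ax xy].
by apply: (near Ue e _ x Ax).
Unshelve. all: by end_near. Qed.

(** By compactness, [A] lies in the thickening of [B] as soon as [B] meets small balls around
    finitely many points of [A]; the other inclusion follows from a single subbasic condition. *)
Lemma nbhs_hausdorff_ball (A : hyperspace M) (e : R) : 0 < e ->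
  nbhs A (hausdorff_ball A e).
Proof.
move=> e0; apply: filterI.
  have /compact_near_coveringP cA := @hset_compact _ A.
  apply: (cA _ (nbhs A) (fun B x => thickening (hset B) e x)) => x Ax.
  have e20 : 0 < e / 2 by rewrite divr_gt0.
  near=> x' B.
  have [b [Bb /interior_subset xb]] : B `&` (ball x (e / 2))° !=set0.
    near: B; apply: (open_nbhs_nbhs (A := vietoris_subbase (false, _))); split.
      by apply: open_vietoris_subbase; exact: open_interior.
    exists x; split=> //; exact: nbhsx_ballx.
  exists b => //; apply: (@ball_splitr _ _ x) => //.
  by near: x'; exact: nbhsx_ballx.
apply: (@filterS _ _ _ (vietoris_subbase (true, (thickening A e)°))).
  by move=> B /= BA x /BA; exact: interior_subset.
apply: open_nbhs_nbhs; split; last exact: thickening_nbhs.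
by apply: open_vietoris_subbase; exact: open_interior.
Unshelve. all: by end_near. Qed.

(** For the converse comparison it suffices to treat subbasic sets: an open set containing the
    compact [A] contains a thickening of it, and meeting an open set persists under small Hausdorff
    perturbations. *)
Let hausdorff_nbhsE : @nbhs _ (hyperspace M) =
  nbhs_ (entourage_ hausdorff_ball).
Proof.
apply/funext => A; apply/seteqP; split=> V.
  pose F := filter_from [set e : R | 0 < e] (hausdorff_ball A).
  have FF : Filter F.
    apply: filter_from_filter; first by exists 1; exact: ltr01.
    move=> e1 e2 /= e10 e20; exists (Num.min e1 e2) => /=.
      by rewrite lt_min e10.
    by move=> B AB; split; apply: le_hausdorff_ball AB;
      rewrite ge_min lexx ?orbT.
  have FA : F --> A.
    apply: cvg_vietoris => -[[] U] /= oU; rewrite /vietoris_subbase /=.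
      move=> /(compact_sub_open_thickening (@hset_compact _ A) oU)[e e0 eU].
      by exists e => // B [_ BA]; exact: subset_trans BA eU.
    move=> [x [Ax Ux]].
    have /nbhs_ballP[r /= r0 rU] : nbhs x U by exact: open_nbhs_nbhs.
    by exists r => // B [/(_ x Ax)[b Bb /ball_sym xb] _]; exists b; split=> //;
      exact: rU.
  move=> /FA[e e0 eV]; exists [set p | hausdorff_ball p.1 e p.2].
    by exists e.
  by move=> B /xsectionP; exact: eV.
move=> [E [e e0 eE] EV]; apply: filterS (nbhs_hausdorff_ball A e0).
by move=> B AB; apply/EV/xsectionP/eE.
Qed.

HB.instance Definition _ := Nbhs_isPseudoMetric.Build R (hyperspace M)
  hausdorff_nbhsE hausdorff_ball_center hausdorff_ball_sym
  hausdorff_ball_triangle erefl.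

HB.instance Definition _ := Uniform_isPseudoMetric.Build R (hyperspace M)
  hausdorff_ball_center hausdorff_ball_sym hausdorff_ball_triangle erefl.

End hyperspace_pseudoMetric.

Lemma le_half (R : realFieldType) (e : R) : 0 < e -> e / 2 <= e.
Proof. by move=> /ltW e0; rewrite ler_pdivrMr // ler_peMr // ler1n. Qed.

Lemma proper_filter_meets (T : Type) (F : set_system T) (A B : set T) :
  ProperFilter F -> F A -> F B -> (A `&` B) !=set0.
Proof. by move=> PF FA FB; apply: (@filter_ex _ F); exact: filterI. Qed.

(** * Completeness of the Hausdorff distance *)

Section hyperspace_complete.
Variables (R : realType) (M : pseudoMetricType R).
Hypotheses (hM : hausdorff_space M) (cM : filter_complete M).

Lemma hyperspace_hausdorff : hausdorff_space (hyperspace M).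
Proof.
have sub (A B : hyperspace M) :
    (forall e : R, 0 < e -> A `<=` thickening B e) -> A `<=` B.
  move=> AB x Ax.
  apply: (compact_closed hM (@hset_compact _ B)) => V /nbhs_ballP[e /= e0 eV].
  have [b Bb /ball_sym xb] := AB e e0 x Ax.
  by exists b; split=> //; exact: eV.
move=> A B AB.
have clAB (e : R) : 0 < e -> A `<=` thickening B e /\ B `<=` thickening A e.
  move=> e0; have e20 : 0 < e / 2 by rewrite divr_gt0.
  have [C [[AC CA] [BC CB]]] := AB _ _ (nbhs_hausdorff_ball A e20)
    (nbhs_hausdorff_ball B e20).
  rewrite (splitr e); split; first exact: thickening_trans AC CB.
  exact: thickening_trans BC CA.
have {}clAB : hset A = hset B.
  by apply/seteqP; split; apply: sub => e /clAB[].
case: A B {AB} clAB => [A cA A0] [B cB B0] /= AB; subst B.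
by rewrite (Prop_irrelevance cA cB) (Prop_irrelevance A0 B0).
Qed.

(** Such an ultrafilter is Cauchy: if it contained no [e]-ball, it would contain all their
    complements, and compactness of [A] would yield a member at distance from all of [A], disjoint
    from the thickening of [A] by [e / 2]. *)
Lemma ultra_thickening_cvg (U : set_system M) : UltraFilter U ->
  (forall e : R, 0 < e -> exists2 A, compact A & U (thickening A e)) ->
  exists x : M, U --> x.
Proof.
move=> UU tU; apply: cM; apply: (@cauchy_exP R M) => e e0;
  apply: contrapT => nU.
have e20 : 0 < e / 2 by rewrite divr_gt0.
have [A /compact_near_coveringP cA UA] := tU _ e20.
have far : \forall y \near U, A `<=` [set x | ~ ball x (e / 2) y].
  apply: (cA M U (fun y x => ~ ball x (e / 2) y)) => x Ax.
  have Ux : U (~` ball x e).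
    have [Ux|//] := in_ultra_setVsetC (ball x e) UU.
    by exfalso; apply: nU; exists x.
  near=> x' y => x'y.
  have : (~` ball x e) y by near: y.
  apply; apply: (@ball_split _ _ x') => //.
  by near: x'; exact: nbhsx_ballx.
have [y [Ay [x Ax xy]]] := proper_filter_meets _ far UA.
exact: (Ay x Ax xy).
Unshelve. all: by end_near. Qed.

Section limit.
Variable F : set_system (hyperspace M).
Hypotheses (PF : ProperFilter F) (cF : cauchy F).

Let near_center (e : R) : 0 < e ->
  exists A : hyperspace M, F (hausdorff_ball A e).
Proof. by move: e; apply/(@cauchyP R). Qed.

(** The lower Kuratowski limit of [F]. *)
Let lim : set M :=
  [set x | forall e : R, 0 < e -> F [set A | A `&` ball x e !=set0]].

Let lim_closed : closed lim.
Proof.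
move=> x xL e e0; have e20 : 0 < e / 2 by rewrite divr_gt0.
have [y [yL xy]] := xL _ (nbhsx_ballx x _ e20).
apply: filterS (yL _ e20) => A [a [Aa ya]].
by exists a; split=> //; exact: ball_split ya.
Qed.

Let lim_sub A (e r : R) : 0 < r -> F (hausdorff_ball A e) ->
  lim `<=` thickening A (e + r).
Proof.
move=> r0 FA x xL.
have [B [[AB BA] [b [Bb xb]]]] := proper_filter_meets _ FA (xL r r0).
have [a Aa ab] := BA b Bb.
by exists a => //; exact: ball_triangle ab (ball_sym xb).
Qed.

(* The traces on [ball a e] of the sets belonging to the members of [F] generate
   a filter, and an ultrafilter refining it converges to the required point. *)
Let sub_lim A (e r : R) : 0 < r -> F (hausdorff_ball A e) ->
  A `<=` thickening lim (e + r).
Proof.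
move=> r0 FA a Aa.
pose H : set_system M :=
  [set V | exists2 P, F P & forall B, P B -> B `&` ball a e `<=` V].
have PH : ProperFilter H.
  apply: Build_ProperFilter_ex.
    move=> V [P FP PV].
    have [B [PB [AB _]]] := proper_filter_meets _ FP FA.
    by have [b Bb /ball_sym ab] := AB a Aa; exists b; apply: (PV B).
  split; first by exists setT => //; exact: filterT.
  - move=> V W [P FP PV] [Q FQ QW]; exists (P `&` Q); first exact: filterI.
    by move=> B [PB QB] b Bb; split; [exact: (PV B)|exact: (QW B)].
  - move=> V W VW [P FP PV]; exists P => // B PB b Bb.
    by apply: VW; exact: (PV B).
have [U [UU HU]] := ultraFilterLemma PH.
have near_U (A' : hyperspace M) (d : R) : F (hausdorff_ball A' d) ->
    U (thickening A' d).
  move=> FA'; apply: HU; exists (hausdorff_ball A' d) => // B [_ BA'] b [Bb _].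
  exact: BA'.
have [x Ux] : exists x : M, U --> x.
  apply: ultra_thickening_cvg => d d0; have [A' FA'] := near_center d0.
  by exists (hset A'); [exact: hset_compact|exact: near_U].
have Ua : U (ball a e)
  by apply: HU; exists setT => [|B _ b []//]; exact: filterT.
exists x; last first.
  have [b [ab xb]] := proper_filter_meets _ Ua (Ux _ (nbhsx_ballx x _ r0)).
  by rewrite addrC; apply: ball_triangle xb _; exact: ball_sym.
move=> d d0; have d20 : 0 < d / 2 by rewrite divr_gt0.
have d40 : 0 < d / 2 / 2 by rewrite divr_gt0.
have [A'' FA''] := near_center d40.
have [b [[a'' Aa'' ab] xb]] := proper_filter_meets _ (near_U _ _ FA'')
  (Ux _ (nbhsx_ballx x _ d40)).
have xa'' : ball x (d / 2) a'' by apply: ball_split xb _; exact: ball_sym.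
apply: filterS FA'' => B [/(_ a'' Aa'')[c Bc ca] _].
exists c; split=> //; apply: ball_split xa'' _; apply: ball_sym.
by apply: le_ball ca; exact: le_half.
Qed.

(** The limit is [lim]. It is closed and lies in thickenings of compact sets at every scale, so each
    ultrafilter on it converges in it and it is compact; [lim_sub] and [sub_lim] bound its Hausdorff
    distance to the members of [F]. *)
Lemma hyperspace_cauchy_cvg : exists L : hyperspace M, F --> L.
Proof.
have lim_compact : compact lim.
  rewrite compact_ultra => U UU UL.
  have [x Ux] : exists x : M, U --> x.
    apply: ultra_thickening_cvg => d d0.
    have d20 : 0 < d / 2 by rewrite divr_gt0.
    have [A FA] := near_center d20.
    exists (hset A); first exact: hset_compact.
    by apply: filterS UL; rewrite (splitr d); exact: lim_sub.
  exists x; split=> //; apply: lim_closed => V /Ux UV.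
  exact: proper_filter_meets UL UV.
have lim_neq0 : lim !=set0.
  have [A FA] := near_center ltr01; have [a Aa] := hset_neq0 A.
  by have [x xL _] := sub_lim ltr01 FA Aa; exists x.
exists (Hyperspace lim_compact lim_neq0) => V /nbhs_ballP[e /= e0 eV].
have e20 : 0 < e / 2 by rewrite divr_gt0.
have e40 : 0 < e / 2 / 2 by rewrite divr_gt0.
have [A FA] := near_center e40.
have e42 : e / 2 / 2 <= e / 2 by exact: le_half.
apply: filterS (FA) => B [AB BA]; apply: eV; rewrite (splitr e); split => /=.
  apply: thickening_trans (subset_trans AB (le_thickening e42)).
  by rewrite (splitr (e / 2)); exact: lim_sub.
apply: thickening_trans (subset_trans BA (le_thickening e42)) _.
by rewrite (splitr (e / 2)); exact: sub_lim.
Qed.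

End limit.

Lemma hyperspace_complete : filter_complete (hyperspace M).
Proof. by move=> F PF; exact: hyperspace_cauchy_cvg. Qed.

End hyperspace_complete.

(** * Sets with few accumulation points *)

Lemma card_II_leP (T : Type) (S : set T) n :
  `I_n #<= S <-> exists a : 'I_n -> T, injective a /\ forall j, S (a j).
Proof.
rewrite (card_le_eql (card_II (n := n))); split.
  case/card_leP => f.
  pose a (j : 'I_n) := \val (f (exist _ j (mem_set I))).
  exists a; split; last by move=> j; exact: set_valP.
  by move=> j j' /val_inj /(@inj _ _ _ f) -/(_ (mem_set I) (mem_set I)) [].
move=> [a [ainj aS]].
have <- : a @^-1` S = setT by apply/seteqP; split=> // j _; exact: aS.
by apply: card_ge_preimage => x y _ _; exact: ainj.
Qed.

Lemma card_le_IIPn (T : Type) (S : set T) n :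
  (S #<= `I_n) <-> ~ (`I_n.+1 #<= S).
Proof.
split=> [Sn nS|nS].
  by have := card_le_trans nS Sn; rewrite card_le_II ltnn.
have [/finite_setP[m Sm]|/infiniteP Sinf] := pselect (finite_set S).
  rewrite (card_le_eql Sm) card_le_II leqNgt; apply/negP => nm.
  by apply: nS; rewrite (card_le_eqr Sm) card_le_II.
by exfalso; apply: nS; apply: card_le_trans Sinf; exact: card_leT.
Qed.

Lemma odd_double_pred k : (0 < k)%N -> odd (k.*2).-1.
Proof. by case: k => // k _; rewrite doubleS /= odd_double. Qed.

Lemma half_double_pred k : (0 < k)%N -> (k.*2).-1./2.+1 = k.
Proof. by case: k => // k _; rewrite doubleS /= uphalf_double. Qed.

Lemma separable_countable_base (R : realType) (M : pseudoMetricType R) :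
  separable M -> exists b : nat -> set M, (forall i, open (b i)) /\
    forall x V, nbhs x V -> exists i, b i x /\ b i `<=` V.
Proof.
case=> D cD dD.
have [D0|] := pfcard_geP cD.
  (* An empty dense set forces [M] to be empty, so any sequence of open sets is a base. *)
  exists (fun=> set0); split=> [i|x]; first exact: open0.
  have [] := dD setT _ openT; first by exists x.
  by move=> y [_]; rewrite D0.
case=> u.
exists (fun n => if unpickle n is Some (i, k) then
  (ball (u i) (k.+1%:R^-1 : R))° else set0); split.
  by move=> n; case: unpickle => [[i k]|]; [exact: open_interior|exact: open0].
move=> x V /nbhs_ballP[e /= e0 eV].
have e20 : 0 < e / 2 by rewrite divr_gt0.
have [k _ /(_ k (leqnn k)) /= /ltW re] := near_infty_natSinv_lt (PosNum e20).
set r := k.+1%:R^-1 in re.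
have r0 : 0 < r by rewrite invr_gt0 ltr0Sn.
have r20 : 0 < r / 2 by rewrite divr_gt0.
have [d [/interior_subset xd Dd]] : (ball x (r / 2))° `&` D !=set0.
  apply: dD; last exact: open_interior.
  by exists x; exact: nbhsx_ballx.
have [i _ ud] := @surj _ _ _ _ u d Dd.
exists (pickle (i, k)); rewrite pickleK ud; split.
  apply: (@filterS _ _ _ (ball x (r / 2))); last exact: nbhsx_ballx.
  by move=> y xy; exact: ball_splitr xd xy.
apply: subset_trans (@interior_subset _ _) _ => y dy; apply: eV.
apply: (@ball_split _ _ d);
  first exact: le_ball (le_trans (le_half r0) re) _ xd.
exact: le_ball dy.
Qed.

Section complexity.
Variables (R : realType) (M : pseudoMetricType R) (b : nat -> set M).
Hypotheses (hM : hausdorff_space M) (ob : forall i, open (b i)).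
Hypothesis bP : forall x V, nbhs x V -> exists i, b i x /\ b i `<=` V.

Definition two_points (O : set M) : set (hyperspace M) :=
  [set A | exists x y, [/\ (A `&` O) x, (A `&` O) y & x <> y]].

Lemma open_two_points (O : set M) : open O -> open (two_points O).
Proof.
move=> oO; rewrite openE => A [x [y [[Ax Ox] [Ay Oy] xy]]].
have [[U V] /= [/set_mem Ux /set_mem Vy] [oU oV /eqP UV]] :
    exists2 UV : set M * set M, x \in UV.1 /\ y \in UV.2 &
      [/\ open UV.1, open UV.2 & UV.1 `&` UV.2 == set0].
  by move: hM; rewrite open_hausdorff => /(_ x y); apply; exact/eqP.
apply: (@filterS _ _ _ (vietoris_subbase (false, O `&` U) `&`
    vietoris_subbase (false, O `&` V))).
  move=> B [[x' [Bx' [Ox' Ux']]] [y' [By' [Oy' Vy']]]].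
  exists x', y'; split=> // xy'; suff : (U `&` V) x' by rewrite UV.
  by split=> //; rewrite xy'.
apply: open_nbhs_nbhs; split.
  by apply: openI; apply: open_vietoris_subbase; exact: openI.
by split; [exists x|exists y].
Qed.

(* The auxiliary point [z] replaces the condition that the two points be close
   to each other: balls of a pseudometric space need not be open. *)
Definition clusters (O C : set M) (r : nat) : set (hyperspace M) :=
  \bigcup_z two_points
    (O `&` (thickening C (r.+1%:R^-1 : R))° `&` (ball z (r.+1%:R^-1 : R))°).

Lemma open_clusters O C r : open O -> open (clusters O C r).
Proof.
move=> oO; apply: bigcup_open => z _; apply: open_two_points.
by apply: openI; [apply: openI => //|]; exact: open_interior.
Qed.

Lemma acc_clusters O C r (A : hyperspace M) a : open O ->
  acc A a -> O a -> C a -> clusters O C r A.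
Proof.
move=> oO Aa Oa Ca; exists a => //.
set W := _ `&` _.
have r0 : 0 < r.+1%:R^-1 :> R by [].
have Wa : nbhs a W.
  apply: filterI; last by apply: nbhs_interior; exact: nbhsx_ballx.
  apply: filterI; first exact: open_nbhs_nbhs.
  by apply: nbhs_interior; exact: (thickening_nbhs r0).
have [y [/eqP ya Ay Wy]] := Aa W Wa.
have Aa' : hset A a
  by apply: (compact_closed hM (@hset_compact _ A)); exact: subset_limit_point.
by exists a, y; split=> //; [split=> //; exact: nbhs_singleton|exact/nesym].
Qed.

(** By compactness of [A] the points [x r] cluster at some [a] in [A], and [y r] stays close to
    [x r]. Since [a] is only approached from [O], it is located in the closure of [O]. *)
Lemma clusters_acc O C (A : hyperspace M) : closed C ->
  (forall r, clusters O C r A) -> exists a, [/\ acc A a, C a & closure O a].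
Proof.
move=> cC Ar.
have /choice[x /choice[y xyP]] r : exists x y, [/\ hset A x, hset A y, x <> y,
    O x & thickening C (r.+1%:R^-1 : R) x /\
    exists z, ball z (r.+1%:R^-1 : R) x /\ ball z (r.+1%:R^-1 : R) y].
  have [z _ [x [y [[Ax [[Ox /interior_subset Cx] /interior_subset zx]]
    [Ay [_ /interior_subset zy]] xy]]]] := Ar r.
  by exists x, y; split=> //; split=> //; exists z.
have [a [Aa xa]] : A `&` cluster (x @ \oo) !=set0.
  apply: (@hset_compact _ A).
  by exists 0%N => // r _; case: (xyP r).
have near_a (e : R) : 0 < e -> exists r, [/\ ball a e (x r), ball a e (y r),
    thickening C e (x r) & O (x r)].
  move=> e0; have e20 : 0 < e / 2 by rewrite divr_gt0.
  have e40 : 0 < e / 2 / 2 by rewrite divr_gt0.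
  have [N _ NP] := near_infty_natSinv_lt (PosNum e40).
  have [|_ [[r Nr <-] ar]] := xa (x @` [set r | (N <= r)%N]) _ _
    (nbhsx_ballx a _ e20).
    by exists N => // r Nr; exists r.
  have /= /ltW re := NP r Nr.
  have [_ _ _ Ox [Cx [z [zx zy]]]] := xyP r.
  have e42 : e / 2 / 2 <= e / 2 by exact: le_half.
  have e2 : e / 2 <= e by exact: le_half.
  exists r; split=> //.
  - exact: le_ball e2 _ ar.
  - apply: ball_split ar _; apply: (@ball_splitr _ _ z);
      exact: le_ball (re) _ _.
  - by apply: le_thickening Cx; rewrite (le_trans re) // (le_trans e42).
exists a; split.
- move=> U /nbhs_ballP[e /= e0 eU].
  have [r [ax ay _ _]] := near_a e e0.
  have [Ax Ay xy _ _] := xyP r.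
  (* At least one of the distinct points [x r], [y r] differs from [a]. *)
  have [xa'|xa'] := eqVneq (x r) a; last by exists (x r); split=> //; exact: eU.
  exists (y r); split=> //; last exact: eU.
  by apply/eqP => ya; apply: xy; rewrite xa' ya.
- apply: cC => V /nbhs_ballP[e /= e0 eV].
  have e20 : 0 < e / 2 by rewrite divr_gt0.
  have [r [ax _ [c Cc cx] _]] := near_a _ e20.
  by exists c; split=> //; apply: eV; apply: ball_split ax _; exact: ball_sym.
- move=> V /nbhs_ballP[e /= e0 eV]; have [r [ax _ _ Ox]] := near_a e e0.
  by exists (x r); split=> //; exact: eV.
Qed.

(** Finitely many pairs admit one [e] such that no two of the points are [e]-close. A basic set
    inside the [e / 4]-ball has its closure inside the [e / 2]-ball, and a common point of two
    closures would make the centers [e]-close. *)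
Lemma separated_base k (a : 'I_k -> M) : injective a ->
  exists t : 'I_k -> nat, (forall j, b (t j) (a j)) /\
    forall i j, i != j -> closure (b (t i)) `&` closure (b (t j)) = set0.
Proof.
move=> ainj.
have sep : \forall e \near (0 : R)^'+,
    forall p : 'I_k * 'I_k, p.1 != p.2 -> ~ ball (a p.1) e (a p.2).
  apply: filter_forall => -[i j] /=.
  have [ij|ij] := eqVneq i j; first by apply: nearW.
  have [e e0 aij] : exists2 e : R, 0 < e & ~ ball (a i) e (a j).
    apply: contrapT => naij; move/eqP: ij; apply; apply: ainj.
    apply: hM => U V /nbhs_ballP[e /= e0 eU] Vj; exists (a j); split.
      apply: eU; apply: contrapT => aij; apply: naij; by exists e.
    exact: nbhs_singleton.
  near=> r => _ rij; apply: aij; apply: le_ball rij.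
  by near: r; exact: nbhs_right_le.
near (0 : R)^'+ => e.
have e20 : 0 < e / 2 by rewrite divr_gt0.
have e40 : 0 < e / 2 / 2 by rewrite divr_gt0.
have /choice[t tP] j := bP (nbhsx_ballx (a j) _ e40).
exists t; split; first by move=> j; case: (tP j).
have clb j w : closure (b (t j)) w -> ball (a j) (e / 2) w.
  move=> /(_ _ (nbhsx_ballx w _ e40))[w' [/(tP j).2 aw' /ball_sym ww']].
  exact: ball_split aw' ww'.
move=> i j ij; rewrite -subset0 => w [/clb iw /clb jw].
have sepe : forall p : 'I_k * 'I_k, p.1 != p.2 -> ~ ball (a p.1) e (a p.2).
  by near: e.
by apply: (sepe (i, j) ij); apply: ball_split iw _; exact: ball_sym.
Unshelve. all: by end_near. Qed.

Definition acc_ge k (F : set M) : set (hyperspace M) :=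
  [set A | `I_k #<= acc A `&` F].

(** A tuple [t] picks for each [j] a basic set and a closed piece of [F]; finite functions are used
    so that there are countably many tuples. Fewer than [k] points means that every tuple with
    disjoint closures fails at some [j] and some scale [r], which is a closed condition;
    disjointness makes the points found for different [j] distinct. *)
Lemma Fsigmadelta_acc_lt k F : Fsigma F -> Fsigmadelta (~` acc_ge k F).
Proof.
move=> [C cC ->].
have -> : ~` acc_ge k (\bigcup_i C i) =
  \bigcap_(t in [set t : {ffun 'I_k -> nat * nat} | forall i j, i != j ->
      closure (b (t i).1) `&` closure (b (t j).1) = set0])
    \bigcup_j \bigcup_r ~` clusters (b (t j).1) (C (t j).2) r.
  apply/seteqP; split=> A.
    move=> nA t tP; apply: contrapT => nt; apply: nA.
    have /choice[a aP] j : exists a, [/\ acc A a, C (t j).2 a &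
        closure (b (t j).1) a].
      apply: clusters_acc => // r; apply: contrapT => nr; apply: nt.
      by exists j => //; exists r.
    apply/card_II_leP; exists a; split; last first.
      by move=> j; have [Aa Ca _] := aP j; split=> //; exists (t j).2.
    move=> i j aij; apply/eqP; apply: contrapT => /negP ij.
    suff : (closure (b (t i).1) `&` closure (b (t j).1)) (a i) by rewrite tP.
    by split; [|rewrite aij]; [case: (aP i)|case: (aP j)].
  move=> At /card_II_leP[a [ainj aP]].
  have [u [ua ucl]] := separated_base ainj.
  have /choice[v vP] j : exists i, C i (a j)
    by have [_ [i _ Ca]] := aP j; exists i.
  have [|j _ [r _]] := At [ffun j => (u j, v j)].
    by move=> i j ij; rewrite !ffunE /=; exact: ucl.
  rewrite ffunE /=; apply; apply: (@acc_clusters _ _ _ _ (a j)) => //.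
  by have [] := aP j.
apply: Fsigmadelta_bigcap => t _; apply: Fsigma_Fsigmadelta.
apply: Fsigma_bigcup => j _; apply: Fsigma_bigcup => r _; apply: closed_Fsigma.
by apply: open_closedC; exact: open_clusters.
Qed.

Lemma acc_ge1 F (A : hyperspace M) : acc_ge 1 F A <-> acc A `&` F !=set0.
Proof.
split; first by move/card_II_leP => [a [_ aP]]; exists (a ord0).
move=> [x xP]; apply/card_II_leP; exists (fun=> x); split=> // i j _.
by rewrite !ord1.
Qed.

Lemma Fsigmadelta_acc_neq0 :
  Fsigmadelta [set A : hyperspace M | acc A !=set0].
Proof.
have -> : [set A : hyperspace M | acc A !=set0] =
    \bigcap_r clusters setT setT r.
  apply/seteqP; split=> A.
    by move=> [a Aa] r _; apply: (acc_clusters _ openT Aa).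
  move=> Ar; have [|a [Aa _ _]] := clusters_acc closedT (A := A) (O := setT).
    by move=> r; exact: Ar.
  by exists a.
apply: Fsigmadelta_bigcap => r _; apply/Fsigma_Fsigmadelta/(@open_Fsigma R).
by apply: open_clusters; exact: openT.
Qed.

(** * Types of the classes inside the hyperspace *)

Lemma Fsigmadelta_cA n : Fsigmadelta (cA M n).
Proof.
have -> : cA M n = [set A : hyperspace M | acc A !=set0] `&`
    ~` acc_ge n.+1 setT.
  by apply/seteqP; split=> A -[A0 An]; split=> //; move: An;
    rewrite card_le_IIPn /acc_ge /= setIT.
apply: Fsigmadelta_setI; first exact: Fsigmadelta_acc_neq0.
by apply: Fsigmadelta_acc_lt; exact/closed_Fsigma/closedT.
Qed.

(** The complement of [F] is open, hence Fsigma, and it must contain fewer than one accumulation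
    point. *)
Lemma Fsigmadelta_cA2_closed n (F : set M) : closed F ->
  Fsigmadelta (cA2 n [set: M] F).
Proof.
move=> cF.
have -> : cA2 n [set: M] F = cA M n `&` ~` acc_ge 1 (~` F).
  apply/seteqP; split=> A.
    by move=> [An _ AF]; split=> // /acc_ge1[x [/AF]].
  move=> [An nA]; split=> // x Ax; apply: contrapT => nFx; apply: nA.
  by apply/acc_ge1; exists x.
apply: Fsigmadelta_setI; first exact: Fsigmadelta_cA.
by apply/Fsigmadelta_acc_lt/(@open_Fsigma R)/closed_openC.
Qed.

Lemma Fsigmadeltasigma_cA_omega : Fsigmadeltasigma (cA_omega M).
Proof.
(* The union starts at index 0, where [cA M 0] is empty. *)
exists (cA M); first exact: Fsigmadelta_cA.
apply/seteqP; split=> A.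
  by move=> [A0 /finite_set_leP[n An]]; exists n.
by move=> [n _ [A0 An]]; split=> //; apply/finite_set_leP; exists n.
Qed.

Lemma Fsigma_meets S : Fsigma S ->
  Fsigma [set A : hyperspace M | A `&` S !=set0].
Proof.
move=> [C cC ->].
have -> : [set A : hyperspace M | A `&` \bigcup_i C i !=set0] =
    \bigcup_i [set A : hyperspace M | A `&` C i !=set0].
  apply/seteqP; split=> A; first by move=> [x [Ax [i _ Cx]]]; exists i => //;
    exists x.
  by move=> [i _ [x [Ax Cx]]]; exists x; split=> //; exists i.
apply: Fsigma_bigcup => i _; apply: closed_Fsigma.
have -> : [set A : hyperspace M | A `&` C i !=set0] =
    ~` vietoris_subbase (true, ~` C i).
  apply/seteqP; split=> A; first by move=> [x [Ax Cx]] /(_ x Ax).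
  move=> nA; apply: contrapT => nAC; apply: nA => x Ax Cx.
  by apply: nAC; exists x.
by apply/open_closedC/open_vietoris_subbase/closed_openC.
Qed.

(** An isolated point of [A] is the only point of [A] in some basic set. So the condition says, for
    each [i], that [A] misses [b i] (closed), has two points in it (open), or meets its part in [F]
    (Fsigma). *)
Lemma Fsigmadelta_isolated_sub F : Fsigma F ->
  Fsigmadelta [set A : hyperspace M | A `\` acc A `<=` F].
Proof.
move=> sF.
have -> : [set A : hyperspace M | A `\` acc A `<=` F] =
    \bigcap_i (~` [set A : hyperspace M | A `&` b i !=set0] `|` two_points (b i)
      `|` [set A : hyperspace M | A `&` (b i `&` F) !=set0]).
  apply/seteqP; split=> A.
    move=> AF i _;
      apply: contrapT => /not_orP[/not_orP[/contrapT[x [Ax bx]] n2] nF].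
    apply: nF; exists x; split=> //; split=> //; apply: AF; split=> // xacc.
    have [y [/eqP yx Ay by_]] := xacc (b i) (open_nbhs_nbhs (conj (ob i) bx)).
    by apply: n2; exists x, y; split=> //; exact/nesym.
  move=> Ab x [Ax]; rewrite not_limit_pointE => -[V xV AV].
  have [i [bx bV]] := bP xV.
  have Abx y : hset A y -> b i y -> y = x by move=> Ay /bV Vy; exact: AV.
  have [[nb|[y [z [[Ay yb] [Az zb] yz]]]]|[y [Ay [yb Fy]]]] := Ab i I.
  - by exfalso; apply: nb; exists x.
  - by exfalso; apply: yz; rewrite (Abx y) // (Abx z).
  - by rewrite -(Abx y).
apply: Fsigmadelta_bigcap => i _; apply: Fsigma_Fsigmadelta.
have sb : Fsigma (b i) by exact: (@open_Fsigma R).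
apply: Fsigma_setU; last by apply: Fsigma_meets; exact: Fsigma_setI.
apply: Fsigma_setU; last by apply: (@open_Fsigma R); exact: open_two_points.
apply: closed_Fsigma; apply: open_closedC.
exact: (@open_vietoris_subbase _ (false, b i) (ob i)).
Qed.

(** An accumulation point off [F], added at index 0 to [k] distinct ones in [F], would give [k + 1]
    of them. *)
Lemma cA_acc_geP k F (A : hyperspace M) : cA M k A ->
  acc_ge k F A -> acc A `<=` F.
Proof.
move=> [_ /card_le_IIPn Ak] /card_II_leP[a [ainj aP]] x Ax.
apply: contrapT => nFx; apply: Ak; apply/card_II_leP.
exists (fun j : 'I_k.+1 => if unlift ord0 j is Some i then a i else x); split.
  move=> i j; case: unliftP => [i'|] ->; case: unliftP => [j'|] -> //.
  - by move=> /ainj ->.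
  - by move=> xa; case: nFx; rewrite -xa; case: (aP i').
  - by move=> xa; case: nFx; rewrite xa; case: (aP j').
by move=> j; case: unlift => [i|//]; case: (aP i).
Qed.

(** [G] is intersected with every member of the chain; it lets the condition on the isolated points
    be added for [cA1]. *)
Lemma D2_acc_sub n F (G : set (hyperspace M)) : Fsigma F -> Fsigmadelta G ->
  D2 n (@Fsigmadelta (hyperspace M))
    [set A : hyperspace M | [/\ cA M n A, acc A `<=` F & G A]].
Proof.
move=> sF sG.
have cAS k l : (k <= l)%N -> cA M k `<=` cA M l.
  move=> kl A [A0 Ak]; split=> //; apply: card_le_trans Ak _.
  by rewrite card_le_II.
(* Both [i = 2k - 1], where [i./2.+1 = k], and [i = 2k], where [i./2 = k], carry the bound [k]. *)
exists (fun i => if odd i then cA M i./2.+1 `&` ~` acc_ge i./2.+1 F `&` G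
  else cA M i./2 `&` G); split.
- move=> i _; case: ifP => _; apply: Fsigmadelta_setI => //;
    last exact: Fsigmadelta_cA.
  by apply: Fsigmadelta_setI; [exact: Fsigmadelta_cA|exact: Fsigmadelta_acc_lt].
- move=> i _; rewrite /= uphalf_half; case: ifP => oi /=.
    by apply: setSI => A [].
  (* From index [2k] to [2k + 1] the bound grows to [k + 1]: at most [k] accumulation points leave
     fewer than [k + 1] in [F]. *)
  rewrite add0n; apply: setSI => A Ai; split; first exact: cAS Ai.
  case: Ai => _ Ai /(card_le_trans)Ai'.
  have := Ai' _ _ (subset_card_le (@subIsetl _ (acc A) F)).
  by move/card_le_trans => /(_ _ _ Ai); rewrite card_le_II ltnn.
- apply/seteqP; split=> A.
    move=> [[A0 An] AF GA].
    (* The exact number [k] of accumulation points of [A] selects the difference that contains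
       [A]. *)
    have /finite_setP[k Ak] : finite_set (acc A)
      by apply/finite_set_leP; exists n.
    have k0 : (0 < k)%N.
      rewrite lt0n; apply/eqP => k0; move: Ak; rewrite k0 II0 card_eq0.
      by move/eqP => A0'; move: A0; rewrite A0' => -[].
    have kn : (k <= n)%N by rewrite -card_le_II -(card_le_eql Ak).
    exists k; first by rewrite /= k0.
    rewrite odd_double /= doubleK.
    rewrite odd_double_pred // half_double_pred //.
    split; first by split=> //; split=> //; rewrite (card_le_eql Ak) card_lexx.
    case=> -[_ nA] _; apply: nA.
    rewrite /acc_ge /= (_ : acc A `&` F = acc A); last exact/setIidPl.
    by rewrite (card_le_eqr Ak) card_lexx.
  case=> k /= /andP[k0 kn]; rewrite odd_double doubleK.
  rewrite odd_double_pred // half_double_pred //.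
  move=> [[Ak GA] nA]; split=> //; first exact: cAS Ak.
  apply: (cA_acc_geP Ak); apply: contrapT => nge; apply: nA.
  by split.
Qed.

End complexity.

(* The absolute types for a Polish space *)
Local Close Scope ring_scope.
Local Close Scope card_scope.

(* A set [B : set (hyperspace X)] is used as a space through its coercion to
   [set_type B], which carries the subspace topology. *)
Theorem corollary2p2 (R : realType) (X : topologicalType) (n : nat)
  (hX : polish R X) (hn : (1 <= n)%N) :
  [/\ absolutely R Fsigmadelta (cA X n) /\
      (forall F : hyperspace X,
         absolutely R Fsigmadelta (cA2 n [set: X] F)),
      absolutely R Fsigmadeltasigma (cA_omega X) &
      forall F : set X, Fsigma F ->
        [/\ absolutely R (fun Z => D2 n (@Fsigmadelta Z)) (cA2 n F [set: X]),
            absolutely R (fun Z => D2 n (@Fsigmadelta Z)) (cA2 n [set: X] F) &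
            absolutely R (fun Z => D2 n (@Fsigmadelta Z)) (cA1 n F)]].
Proof.
case: hX => sX [M0 /complete_metric_filter cM0].
case/homeomorphic_pseudoMetric => M [XM hM /(_ cM0) cM]; subst X.
have [b [ob bP]] := separable_countable_base sX.
have hK := hyperspace_hausdorff hM.
have cK := hyperspace_complete cM.
split.
- split=> [|F].
    by apply: (absolutely_Fsigmadelta hK cK); exact: (Fsigmadelta_cA hM ob bP).
  apply: (absolutely_Fsigmadelta hK cK).
  apply: (Fsigmadelta_cA2_closed hM ob bP).
  exact: compact_closed (@hset_compact _ F).
- apply: (absolutely_Fsigmadeltasigma hK cK).
  exact: (Fsigmadeltasigma_cA_omega hM ob bP).
- move=> F sF; have sI := Fsigmadelta_isolated_sub hM ob bP sF.
  split; apply: (absolutely_D2 hK cK).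
  (* Constraining only the isolated points keeps the type Fsigmadelta, which is contained in [D2 n]
     because [n >= 1]. *)
  + apply: D2_Fsigmadelta => //.
    have -> : cA2 n F [set: M] = cA M n `&`
        [set A : hyperspace M | A `\` acc A `<=` F].
      by apply/seteqP; split=> A; [case|case=> ? ?; split].
    by apply: Fsigmadelta_setI => //; exact: (Fsigmadelta_cA hM ob bP).
  + have sT : Fsigmadelta [set: hyperspace M].
      by apply: Fsigma_Fsigmadelta; apply: closed_Fsigma; exact: closedT.
    have := D2_acc_sub hM ob bP n sF sT; congr (D2 _ _ _).
    by apply/seteqP; split=> A [].
  (* As [A] is closed, it contains its accumulation points, so being a subset of [F] splits into one
     condition on these and one on the isolated points, the latter serving as [G]. *)
  + have := D2_acc_sub hM ob bP n sF sI; congr (D2 _ _ _).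
    apply/seteqP; split=> A.
      move=> [An AF IF]; split=> // x Ax.
      by have [/AF//|nx] := pselect (acc A x); apply: IF.
    move=> [An AF]; split=> // x; last by case=> /AF.
    move=> /subset_limit_point Ax; apply: AF.
    exact: (compact_closed hM (@hset_compact _ A)).
Qed.
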